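(* Let $M$ be a matrix (smoother) such that $M+M^T-A$ is symmetric positive definite, let $\overline{M}=M(M+M^T-A)^{-1}M^T$, let $S$ be a symmetric positive definite preconditioner for the Schur complement $\Sigma$, and let $\mathcal{B}_{\mathrm{sc}}^{-1}$ be the corresponding static condensation preconditioner for $\mathcal{A}$. Then the auxiliary space preconditioners $$B^{-1}_{\mathrm{add}}=\overline{M}^{-1}+\Pi_H\,\mathcal{B}_{\mathrm{sc}}^{-1}\,\Pi_H^T,$$ $$B^{-1}_{\mathrm{mult}}=\overline{M}^{-1}+(I-M^{-T}A)\,\Pi_H\,\mathcal{B}_{\mathrm{sc}}^{-1}\,\Pi_H^T\,(I-AM^{-1})$$ are symmetric positive definite.
   Context: **Mesh and original problem.** $\Omega\subset\mathbb{R}^d$ is a domain with Lipschitz boundary, $\mathcal{T}^h$ a triangulation of $\Omega$, and $\mathcal{U}^h\subset H^1_0(\Omega)$ the space of continuous piecewise polynomial finite element functions on $\mathcal{T}^h$ with the usual nodal degrees of freedom (dofs). Functions are identified with their coefficient vectors. $\kappa\in L^\infty(\Omega)$, $\kappa>0$, and $A$ is the symmetric positive definite (SPD) stiffness matrix of $a(u,v)=\int_\Omega\kappa\nabla u\cdot\nabla v$ on $\mathcal{U}^h$. $\mathcal{T}^H$ is a partition of $\mathcal{T}^h$ into non-overlapping connected sets $T$ of elements (agglomerates). $A_T$ is the symmetric positive semidefinite (SPSD) stiffness matrix of the same form restricted to $T$, on the dofs contained in $T$; $A=\sum_T A_T$ (with implicit local-to-global mapping); the null space of $A_T$ is either trivial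 or spanned by the constant vector, and at least one $A_T$ is nonsingular because of the essential boundary condition. $\Phi^H$ is the set of agglomerate faces: each $F\in\Phi^H$ is the $(d-1)$-dimensional interface, a union of fine faces, between two adjacent agglomerates $T_+,T_-\in\mathcal{T}^H$; then $F\subset\partial T_\pm$. **Nonconforming spaces.** $\mathcal{E}^h$ consists of functions on $\Omega$ whose restriction to each $T\in\mathcal{T}^H$ is the restriction of some function in $\mathcal{U}^h$, with no continuity between different $T$; its degrees of freedom (edofs) are obtained by giving each $T$ its own copy of every dof contained in $T$. For a dof $l$, $J_l$ is the set of its copies. $\mathcal{F}^h$ consists of functions on $\bigcup_F F$ that on each $F\in\Phi^H$ are traces of functions in $\mathcal{U}^h$; its degrees of freedom (bdofs) are copies, one for each $F$, of the dofs contained in $F$. $\cdot|_T$ and $\cdot|_F$ denote the corresponding subvectors. Subspaces $\mathcal{E}^H\subset\mathcal{E}^h$ and $\mathcal{F}^H\subset\mathcal{F}^h$ are given by bases of linearly independent vectors $\{\mathbf q_{T,i}\}_{i=1}^{m_T}$ on the edofs of each $T$ and $\{\mathbf q_{F,i}\}_{i=1}^{m_F}$ on the bdofs of each $F$; $\mathcal{P}_T$, $\mathcal{P}_F$ are the matrices with these columns, and $\mathcal{P}_e=\operatorname{diag}(\mathcal{P}_T)_T$, $\mathcal{P}_b=\operatorname{diag}(\mathcal{P}_F)_F$ the prolongations. Elements of $\mathcal{E}^H,\mathcal{F}^H$ are identified with their coefficient vectors in these bases. $D_F$ is the restriction of the diagonal of $A$ to the bdofs of $F$. It is assumed that $\mathcal{F}^H$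 contains the constants on each $F$ and that $\operatorname{span}\{\mathbf q_{F,i}\}$ is a proper subspace of the trace space on $F$ of $\mathcal{E}^H$. **Mortar matrices.** On $\mathcal{E}^H\times[\mathcal{F}^H]^2\times\mathcal{F}^H$, where $[\mathcal{F}^H]^2$ is the space of multipliers $\boldsymbol\mu=(\boldsymbol\mu_{T,F})_{T\in\mathcal{T}^H,F\subset\partial T}$, $\boldsymbol\mu_{T,F}\in\mathbb{R}^{m_F}$, let $$\mathcal{A}=\begin{bmatrix}\mathcal{A}_{ee}&C^T&\\ C&&-X\\ &-X^T&\end{bmatrix},\qquad \mathfrak{A}=\begin{bmatrix}\mathcal{A}_{ee}&C^T\\ C&\end{bmatrix},$$ with $\mathbf v^T\mathcal{A}_{ee}\mathbf u=\sum_T[(\mathcal{P}_e\mathbf v)|_T]^TA_T(\mathcal{P}_e\mathbf u)|_T$, $\boldsymbol\mu^TC\mathbf u=\sum_T\sum_{F\subset\partial T}(\mathcal{P}_F\boldsymbol\mu_{T,F})^TD_F((\mathcal{P}_e\mathbf u)|_T)|_F$, and $\boldsymbol\mu^TX\mathbf p=\sum_T\sum_{F\subset\partial T}(\mathcal{P}_F\boldsymbol\mu_{T,F})^TD_F(\mathcal{P}_b\mathbf p)|_F$. The formulation is assumed not over-constrained, i.e. $C$ has full row rank; then $\mathfrak{A}$ is invertible and the Schur complement $\Sigma=-[O,-X^T]\,\mathfrak{A}^{-1}\,[O,-X^T]^T$ is SPD. **Static condensation preconditioner.** For an SPD matrix $S$ on $\mathcal{F}^H$, $$\mathcal{B}_{\mathrm{sc}}^{-1}=\begin{bmatrix}I&-\mathfrak{A}^{-1}\begin{bmatrix}O\\-X\end{bmatrix}\\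 O&I\end{bmatrix}\begin{bmatrix}\mathfrak{A}^{-1}&O\\-S^{-1}[O,-X^T]\mathfrak{A}^{-1}&S^{-1}\end{bmatrix},$$ in the block partition $(\mathcal{E}^H\times[\mathcal{F}^H]^2)\times\mathcal{F}^H$. **Transfer operators.** $\Pi_{h,e}:\mathcal{E}^h\to\mathcal{U}^h$ is averaging: $(\Pi_{h,e}\hat{\mathbf v})_l=\frac1{|J_l|}\sum_{j\in J_l}(\hat{\mathbf v})_j$ for each dof $l$; and $\Pi_H=[\Pi_{h,e}\mathcal{P}_e,\,O,\,O]:\mathcal{E}^H\times[\mathcal{F}^H]^2\times\mathcal{F}^H\to\mathcal{U}^h$. *)

(* Defs.v *)
From HB Require Import structures.
From mathcomp Require Import all_boot all_order all_algebra.
From mathcomp Require Import reals.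
Set Implicit Arguments.
Unset Strict Implicit.
Unset Printing Implicit Defensive.
Import Order.TTheory GRing.Theory Num.Theory.
Local Open Scope ring_scope.

Section LinearAlgebra.
Variable R : realType.

Definition spd n (A : 'M[R]_n) : Prop :=
  A^T = A /\ (forall v : 'cV[R]_n, v != 0 -> 0 < (v^T *m A *m v) 0 0).

Definition spsd n (A : 'M[R]_n) : Prop :=
  A^T = A /\ (forall v : 'cV[R]_n, 0 <= (v^T *m A *m v) 0 0).

(* Dofs are numbered by 'I_n.  A vector on a set D of dofs has type
   'cV_#|D|, its entries following the enumeration of D; [rst D] extracts
   such a subvector from a global vector and [rst D]^T extends it by zero. *)
Definition rst n (D : {set 'I_n}) : 'M[R]_(#|D|, n) := rowsub enum_val 1%:M.

(* v |-> v|_F for v living on T, when F is a subset of T. *)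
Definition rst_in n (F T : {set 'I_n}) : 'M[R]_(#|F|, #|T|) :=
  rst F *m (rst T)^T.

(* The i-th block of a vector of length \sum_i p i. *)
Definition blk k (p : 'I_k -> nat) (i : 'I_k) : 'M[R]_(p i, \sum_i p i) :=
  submxcol 1%:M i.

(* diag(B_i)_i with rectangular blocks (\mxdiag needs square ones). *)
Definition blockdiag k (p q : 'I_k -> nat) (B : forall i, 'M[R]_(p i, q i)) :
    'M[R]_(\sum_i p i, \sum_i q i) :=
  \mxcol_i (B i *m blk q i).

End LinearAlgebra.

Definition share_face (E F : finType) (felt : F -> {set E}) : rel E :=
  [rel x y | [exists f, (x \in felt f) && (y \in felt f)]].

(* A triangulation and its nodal dofs.  [fface] is the type of fine faces,
   [felt f] the set of the (one or two) elements having f as a face; [edof]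
   and [fdof] give the dofs contained in a closed element, resp. fine face
   (nodes on the essential boundary are not dofs).  [elt_connected] holds
   because the triangulated set is a domain. *)
Record mesh (n : nat) := Mesh {
  elt : finType;
  fface : finType;
  felt : fface -> {set elt};
  edof : elt -> {set 'I_n};
  fdof : fface -> {set 'I_n};
  felt_card : forall f, (0 < #|felt f| <= 2)%N;
  fdof_sub : forall f e, e \in felt f -> fdof f \subset edof e;
  edof_cover : forall l, exists e, l \in edof e;
  elt_connected : forall e e' : elt,
    connect (share_face felt) e e'
}.

(* The partition of the elements into agglomerates, as a labelling [agg] of
   the elements by 'I_nagg. *)
Record agglomeration n (m : mesh n) := Agglomeration {
  nagg : nat;
  agg : elt m -> 'I_nagg;
  agg_surj : forall T, exists e, agg e = T;
  agg_connected : forall e e', agg e = agg e' ->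
    connect [rel x y | [&& share_face (@felt n m) x y, agg x == agg e & agg y == agg e]] e e'
}.

Section Mortar.
Variables (R : realType) (n : nat) (m : mesh n) (g : agglomeration m).

Definition aggs_of (f : fface m) : {set 'I_(nagg g)} := @agg n m g @: felt f.

(* The interface between the adjacent agglomerates T+ and T- is encoded by
   the pair {T+, T-}; F \subset \partial T then means T \in faceT F. *)
Definition PhiH : {set {set 'I_(nagg g)}} :=
  [set P in [set aggs_of f | f in fface m] | #|P| == 2].

Notation aggl := 'I_(nagg g).
Notation face := 'I_#|PhiH|.

Definition faceT (F : face) : {set aggl} := enum_val F.

Definition dofT (T : aggl) : {set 'I_n} := \bigcup_(e | agg g e == T) edof e.

Definition dofF (F : face) : {set 'I_n} :=
  \bigcup_(f | aggs_of f == faceT F) fdof f.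

(* The pairs (T, F) with F \subset \partial T, which index [F^H]^2. *)
Definition bnd : {set aggl * face} := [set TF | TF.1 \in faceT TF.2].
Definition bT (k : 'I_#|bnd|) : aggl := (enum_val k).1.
Definition bF (k : 'I_#|bnd|) : face := (enum_val k).2.

Section Stiffness.
(* [a e] is the matrix of the form \int_e kappa grad u . grad v on the dofs
   of the element e. *)
Variable a : forall e : elt m, 'M[R]_#|edof e|.

Definition stiff : 'M[R]_n := \sum_e (rst R (edof e))^T *m a e *m rst R (edof e).

Definition stiffT (T : aggl) : 'M[R]_#|dofT T| :=
  \sum_(e | agg g e == T)
    (rst_in R (edof e) (dofT T))^T *m a e *m rst_in R (edof e) (dofT T).

Definition DF (F : face) : 'M[R]_#|dofF F| :=
  diag_mx (\row_i stiff (enum_val i) (enum_val i)).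
End Stiffness.

(* The null space of the matrix B is trivial or spanned by the constants. *)
Definition null_trivial_or_const k (B : 'M[R]_k) : Prop :=
  (forall v : 'cV[R]_k, B *m v = 0 -> v = 0) \/
  (forall v : 'cV[R]_k, B *m v = 0 <-> exists c : R, v = const_mx c).

Section Coarse.
Variables (a : forall e : elt m, 'M[R]_#|edof e|).
Variables (mT : aggl -> nat) (mF : face -> nat).
Variables (PT : forall T, 'M[R]_(#|dofT T|, mT T)).
Variables (PF : forall F, 'M[R]_(#|dofF F|, mF F)).

Definition dimE : nat := \sum_T mT T.
Definition dimM : nat := \sum_k mF (bF k).
Definition dimF : nat := \sum_F mF F.

Definition Pe : 'M[R]_(\sum_T #|dofT T|, dimE) := blockdiag PT.
Definition Pb : 'M[R]_(\sum_F #|dofF F|, dimF) := blockdiag PF.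

(* Columns q_{F,i} contain the constants on F in their span. *)
Definition contains_constants (F : face) : Prop :=
  exists c : 'cV[R]_(mF F), PF F *m c = const_mx 1.

(* span{q_{F,i}} is a proper subspace of the space spanned by the traces on F,
   from either side, of the functions of E^H (spans of columns are row spaces
   of transposes). *)
Definition proper_in_trace (F : face) : Prop :=
  ((PF F)^T < \sum_(T in faceT F)
                <<(rst_in R (dofF F) (dofT T) *m PT T)^T>>)%MS.

Definition Aee : 'M[R]_dimE :=
  \sum_T (submxcol Pe T)^T *m stiffT a T *m submxcol Pe T.

Definition Cmx : 'M[R]_(dimM, dimE) :=
  \sum_k (PF (bF k) *m blk R (fun k => mF (bF k)) k)^T *m DF a (bF k)
         *m (rst_in R (dofF (bF k)) (dofT (bT k)) *m submxcol Pe (bT k)).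

Definition Xmx : 'M[R]_(dimM, dimF) :=
  \sum_k (PF (bF k) *m blk R (fun k => mF (bF k)) k)^T *m DF a (bF k)
         *m submxcol Pb (bF k).

Definition frakA : 'M[R]_(dimE + dimM) := block_mx Aee Cmx^T Cmx 0.

(* The matrix that Bsc_inv preconditions. *)
Definition calA : 'M[R]_(dimE + dimM + dimF) :=
  block_mx frakA (col_mx 0 (- Xmx)) (row_mx 0 (- Xmx^T)) 0.

(* The Schur complement of calA that S approximates; of S, only that it is SPD
   on F^H is required. *)
Definition Sigma : 'M[R]_dimF :=
  - (row_mx 0 (- Xmx^T) *m invmx frakA *m (row_mx 0 (- Xmx^T))^T).

Definition Bsc_inv (S : 'M[R]_dimF) : 'M[R]_(dimE + dimM + dimF) :=
  block_mx 1%:M (- (invmx frakA *m col_mx 0 (- Xmx))) 0 1%:M *m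
  block_mx (invmx frakA) 0
           (- (invmx S *m row_mx 0 (- Xmx^T) *m invmx frakA)) (invmx S).

(* The dof of which the edof j is a copy. *)
Definition edof_dof (j : 'I_(\sum_T #|dofT T|)) : 'I_n :=
  enum_val (tagnat.sig2 j).

Definition copies (l : 'I_n) : {set 'I_(\sum_T #|dofT T|)} :=
  [set j | edof_dof j == l].

Definition Pi_he : 'M[R]_(n, \sum_T #|dofT T|) :=
  \matrix_(l, j) ((j \in copies l)%:R / #|copies l|%:R).

Definition PiH : 'M[R]_(n, dimE + dimM + dimF) :=
  row_mx (row_mx (Pi_he *m Pe) 0) 0.

Definition Mbar (M : 'M[R]_n) : 'M[R]_n :=
  M *m invmx (M + M^T - stiff a) *m M^T.

Definition Badd_inv (M : 'M[R]_n) (S : 'M[R]_dimF) : 'M[R]_n :=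
  invmx (Mbar M) + PiH *m Bsc_inv S *m PiH^T.

Definition Bmult_inv (M : 'M[R]_n) (S : 'M[R]_dimF) : 'M[R]_n :=
  invmx (Mbar M) +
  (1%:M - invmx M^T *m stiff a) *m PiH *m Bsc_inv S *m PiH^T
    *m (1%:M - stiff a *m invmx M).

End Coarse.
End Mortar.

(* Main.v *)
(* Since PiH sees only the E^H block, PiH B_sc^{-1} PiH^T is, with Y = [O; -X] and
   W the restriction of PiH to the first two blocks,
   W frakA^{-1} W^T + (W frakA^{-1} Y) S^{-1} (W frakA^{-1} Y)^T.
   The second term is a congruence of S^{-1}.  In the first one, W^T v = [f; 0], so
   [u; mu] = frakA^{-1} W^T v satisfies C u = 0, and the form equals u^T Aee u >= 0.
   M is invertible because v^T (M + M^T) v > v^T A v, so Mbar^{-1} is SPD, and adding it gives the result for both preconditioners. *)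
Require Import Defs.
From mathcomp Require Import all_boot all_order all_algebra.
From mathcomp Require Import reals.
Set Implicit Arguments.
Unset Strict Implicit.
Unset Printing Implicit Defensive.
Import Order.TTheory GRing.Theory Num.Theory.
Local Open Scope ring_scope.

Section PositiveMatrices.
Variable R : realType.

Lemma trmx11 (B : 'M[R]_1) : B^T = B.
Proof. by apply/matrixP=> i j; rewrite mxE !ord1. Qed.

(** Stated without symmetry so that it applies to the smoother [M]: a left kernel vector would make
    the form vanish. *)
Lemma posdef_unitmx n (B : 'M[R]_n) :
  (forall v : 'cV_n, v != 0 -> 0 < (v^T *m B *m v) 0 0) -> B \in unitmx.
Proof.
move=> B_gt0; rewrite -row_free_unit; apply: inj_row_free => v vB.
have [//|v_neq0] := eqVneq v 0.
have := B_gt0 v^T; rewrite trmx_eq0 trmxK vB mul0mx mxE ltxx.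
by move/(_ v_neq0).
Qed.

Lemma spd_unitmx n (B : 'M[R]_n) : spd B -> B \in unitmx.
Proof. by case=> _; apply: posdef_unitmx. Qed.

Lemma spd_spsd n (B : 'M[R]_n) : spd B -> spsd B.
Proof.
case=> B_sym B_gt0; split=> // v.
by have [->|/B_gt0/ltW//] := eqVneq v 0; rewrite mulmx0 mxE.
Qed.

Lemma spsd0 n : spsd (0 : 'M[R]_n).
Proof. by split=> [|v]; rewrite ?trmx0 // mulmx0 mul0mx mxE. Qed.

Lemma spsdD n (B D : 'M[R]_n) : spsd B -> spsd D -> spsd (B + D).
Proof.
move=> [B_sym B_ge0] [D_sym D_ge0]; split=> [|v].
  by rewrite linearD /= B_sym D_sym.
by rewrite mulmxDr mulmxDl mxE addr_ge0.
Qed.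

Lemma spd_spsdD n (B D : 'M[R]_n) : spd B -> spsd D -> spd (B + D).
Proof.
move=> [B_sym B_gt0] [D_sym D_ge0]; split=> [|v v_neq0].
  by rewrite linearD /= B_sym D_sym.
by rewrite mulmxDr mulmxDl mxE ltr_wpDr // B_gt0.
Qed.

Lemma spsd_sum n (I : finType) (P : pred I) (B : I -> 'M[R]_n) :
  (forall i, P i -> spsd (B i)) -> spsd (\sum_(i | P i) B i).
Proof.
by move=> B_spsd; apply: big_ind => //; [apply: spsd0 | apply: spsdD].
Qed.

Lemma congr_form n k (B : 'M[R]_n) (D : 'M[R]_(n, k)) (v : 'cV_k) :
  v^T *m (D^T *m B *m D) *m v = (D *m v)^T *m B *m (D *m v).
Proof. by rewrite trmx_mul !mulmxA. Qed.

Lemma congr_sym n k (B : 'M[R]_n) (D : 'M[R]_(n, k)) :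
  B^T = B -> (D^T *m B *m D)^T = D^T *m B *m D.
Proof. by move=> B_sym; rewrite !trmx_mul trmxK B_sym mulmxA. Qed.

Lemma spsd_congr n k (B : 'M[R]_n) (D : 'M[R]_(n, k)) :
  spsd B -> spsd (D^T *m B *m D).
Proof.
by case=> B_sym B_ge0; split=> [|v]; rewrite ?congr_sym // congr_form.
Qed.

Lemma spd_congr n (B D : 'M[R]_n) :
  D \in unitmx -> spd B -> spd (D^T *m B *m D).
Proof.
move=> D_unit [B_sym B_gt0]; split=> [|v v_neq0]; first exact: congr_sym.
rewrite congr_form B_gt0 //; apply: contra_neq v_neq0 => Dv.
by rewrite -(mulKmx D_unit v) Dv mulmx0.
Qed.

Lemma spd_invmx n (B : 'M[R]_n) : spd B -> spd (invmx B).
Proof.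
move=> B_spd; have B_unit := spd_unitmx B_spd.
(* For symmetric [B], the inverse is itself a congruence of [B]: B^{-1} = B^{-T} B B^{-1}. *)
have := @spd_congr _ B (invmx B).
by rewrite unitmx_inv trmx_inv B_spd.1 mulVmx // mul1mx; apply.
Qed.

(* When the saddle point matrix is singular, [invmx] returns it unchanged, and
   the quadratic form is then that of B at f. *)
Lemma saddle_invmx_ge0 p q (B : 'M[R]_p) (D : 'M[R]_(q, p)) (f : 'cV_p) :
  spsd B ->
  0 <= ((col_mx f 0)^T *m invmx (block_mx B D^T D 0) *m col_mx f 0) 0 0.
Proof.
move=> [B_sym B_ge0]; set K := block_mx B D^T D 0.
have [K_unit|K_sing] := boolP (K \in unitmx); last first.
  rewrite /invmx (negPf K_sing) tr_col_mx trmx0 mul_row_block mul_row_col.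
  by rewrite !mul0mx mulmx0 !addr0.
have [w Kw] : exists w, K *m w = col_mx f 0.
  by exists (invmx K *m col_mx f 0); rewrite mulKVmx.
rewrite -mulmxA -{2}Kw mulKmx //; rewrite -(vsubmxK w) in Kw *.
set u := usubmx w in Kw *; set mu := dsubmx w in Kw *.
(* The form is now f^T u. Block rows give f = B u + D^T mu and D u = 0, so mu drops out and u^T B u
   remains. *)
move: Kw; rewrite mul_block_col mul0mx addr0 => /eq_col_mx [<- Du].
rewrite tr_col_mx mul_row_col trmx0 mul0mx addr0 linearD /= !trmx_mul trmxK.
by rewrite B_sym mulmxDl -[_ *m D *m u]mulmxA Du mulmx0 addr0.
Qed.

Lemma smoother_unitmx n (A M : 'M[R]_n) :
  spd A -> spd (M + M^T - A) -> M \in unitmx.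
Proof.
move=> [_ A_gt0] [_ N_gt0]; apply: posdef_unitmx => v v_neq0.
have : 0 < (v^T *m (M + M^T - A + A) *m v) 0 0.
  by rewrite mulmxDr mulmxDl mxE addr_gt0 ?N_gt0 ?A_gt0.
rewrite subrK mulmxDr mulmxDl mxE.
(* A 1x1 matrix is its own transpose, so the form of M + M^T is twice that of M. *)
have -> : v^T *m M^T *m v = v^T *m M *m v.
  by rewrite -[LHS]trmx11 !trmx_mul !trmxK mulmxA.
by rewrite -mulr2n pmulrn_lgt0.
Qed.

End PositiveMatrices.

Section AuxiliarySpace.
Variables (R : realType) (n : nat) (m : mesh n) (g : agglomeration m).
Variable a : forall e : elt m, 'M[R]_#|edof e|.
Variables (mT : 'I_(nagg g) -> nat) (mF : 'I_#|PhiH g| -> nat).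
Variable PT : forall T : 'I_(nagg g), 'M[R]_(#|dofT T|, mT T).
Variable PF : forall F : 'I_#|PhiH g|, 'M[R]_(#|dofF F|, mF F).
Hypothesis a_spsd : forall e, spsd (a e).

Lemma Aee_spsd : spsd (Aee a PT).
Proof.
apply: spsd_sum => T _; apply: spsd_congr.
by apply: spsd_sum => e _; apply: spsd_congr.
Qed.

Lemma frakA_sym : (frakA a PT PF)^T = frakA a PT PF.
Proof. by rewrite tr_block_mx trmxK trmx0 Aee_spsd.1. Qed.

(** Only semidefiniteness is claimed, as [PiH^T] may have a kernel; strict positivity will come from
    the smoother. *)
Lemma Pi_Bsc_inv_spsd (S : 'M[R]_(dimF mF)) :
  spd S -> spsd (PiH mF PT *m Bsc_inv a PT PF S *m (PiH mF PT)^T).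
Proof.
move=> S_spd; rewrite /Bsc_inv /PiH.
set Z := invmx _; set Y := col_mx _ _; set W := row_mx (Pi_he _ _ *m _) 0.
have Z_sym : Z^T = Z by rewrite trmx_inv frakA_sym.
have -> : row_mx 0 (- (Xmx a PF)^T) = Y^T.
  by rewrite tr_col_mx trmx0 linearN.
(* Only the leading block Z + Z Y S^{-1} Y^T Z of [Bsc_inv] survives, the two minus signs
   cancelling. The double transpose puts the second term in the shape of [spsd_congr]. *)
have -> : row_mx W 0 *m (block_mx 1%:M (- (Z *m Y)) 0 1%:M *m
    block_mx Z 0 (- (invmx S *m Y^T *m Z)) (invmx S)) *m (row_mx W 0)^T =
    W *m Z *m W^T + ((W *m Z *m Y)^T)^T *m invmx S *m (W *m Z *m Y)^T.
  rewrite mulmxA mul_row_block mul_row_block tr_row_mx mul_row_col trmx0.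
  rewrite !mulmx0 !mul0mx !addr0 mulmx1 trmxK !trmx_mul Z_sym.
  by rewrite mulmxN mulmxN mulNmx opprK mulmxDl !mulmxA.
apply: spsdD; last exact/spsd_congr/spd_spsd/spd_invmx.
split=> [|v]; first by rewrite !trmx_mul trmxK Z_sym mulmxA.
have -> : v^T *m (W *m Z *m W^T) *m v = (W^T *m v)^T *m Z *m (W^T *m v).
  by rewrite trmx_mul trmxK !mulmxA.
(* The zero block of W kills the multiplier component of W^T v. *)
by rewrite tr_row_mx trmx0 mul_col_mx mul0mx; apply/saddle_invmx_ge0/Aee_spsd.
Qed.

End AuxiliarySpace.

Theorem proposition6p1 (R : realType) (n : nat) (m : mesh n)
  (g : agglomeration m)
  (a : forall e : elt m, 'M[R]_#|edof e|)
  (a_spsd : forall e, spsd (a e))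
  (A_spd : spd (stiff a))
  (AT_null : forall T : 'I_(nagg g), null_trivial_or_const (stiffT a T))
  (AT_nonsing : exists T : 'I_(nagg g), stiffT a T \in unitmx)
  (mT : 'I_(nagg g) -> nat) (mF : 'I_#|PhiH g| -> nat)
  (PT : forall T : 'I_(nagg g), 'M[R]_(#|dofT T|, mT T))
  (PF : forall F : 'I_#|PhiH g|, 'M[R]_(#|dofF F|, mF F))
  (PT_free : forall T, row_free (PT T)^T)
  (PF_free : forall F, row_free (PF F)^T)
  (PF_const : forall F, contains_constants PF F)
  (PF_proper : forall F, proper_in_trace PT PF F)
  (C_full_row_rank : row_free (Cmx a PT PF))
  (M : 'M[R]_n) (M_smoother : spd (M + M^T - stiff a))
  (S : 'M[R]_(dimF mF)) (S_spd : spd S) :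
  spd (Badd_inv a PT PF M S) /\ spd (Bmult_inv a PT PF M S).
Proof.
have M_unit := smoother_unitmx A_spd M_smoother.
have Mbar_spd : spd (invmx (Mbar a M)).
  (* Reading the left factor M as (M^T)^T makes [Mbar] a congruence by M^T. *)
  apply: spd_invmx; rewrite /Mbar -{1}[M]trmxK.
  by apply: spd_congr; [rewrite unitmx_tr | apply: spd_invmx].
have Pi_spsd := Pi_Bsc_inv_spsd PT PF a_spsd S_spd.
split; apply: spd_spsdD => //.
(* The additive case is closed by [Pi_spsd]. Since A is symmetric, the multiplicative correction is
   the additive one under congruence by G. *)
set G := 1%:M - stiff a *m invmx M.
have -> : 1%:M - invmx M^T *m stiff a = G^T.
  by rewrite linearB /= trmx1 trmx_mul trmx_inv A_spd.1.
have -> (Q : 'M_(dimE mT + dimM mF + dimF mF)) :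
    G^T *m PiH mF PT *m Q *m (PiH mF PT)^T *m G =
    G^T *m (PiH mF PT *m Q *m (PiH mF PT)^T) *m G by rewrite !mulmxA.
exact: spsd_congr.
Qed.
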